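(* For every integer $n \geq 3$, $$A_n = \frac{n-1}{n}A_{n-2} + \begin{cases} \dfrac{8}{n^2\pi}, & \text{for } n \text{ odd;}\\[2ex] \dfrac{16}{n^2\pi}, & \text{for } n \text{ even.}\end{cases}$$
   Context: For a positive integer $n$, $A_n$ denotes the limiting area between the graphs of $\cos^n x$ and $\cos^n kx$ over $[0,\pi]$: $$A_n = \lim_{k \to \infty} \int_0^\pi \big| \cos^n x - \cos^n (kx) \big| \, dx,$$ where $k$ runs through the positive integers (both parities). Here $\cos^n \theta = (\cos\theta)^n$. *)

(* Defs.v *)
(* Stdlib real numbers with Coquelicot's RInt and Lim_seq. *)
From Stdlib Require Import Reals Arith.
From Coquelicot Require Import Coquelicot.
Open Scope R_scope.

Definition area (n k : nat) : R :=
  RInt (fun x => Rabs (cos x ^ n - cos (INR k * x) ^ n)) 0 PI.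

(* Indexed from 0 over nat, so that [S k] runs through the positive integers. *)
Definition area_seq (n : nat) : nat -> R := fun k => area n (S k).

(* [Lim_seq] is total: this is the limiting area only when [area_seq n]
   has a finite limit. *)
Definition A (n : nat) : R := real (Lim_seq (area_seq n)).

(* Main.v *)
Require Import Defs.
From Stdlib Require Import Reals Arith Lra Lia.
From Coquelicot Require Import Coquelicot.
Open Scope R_scope.

(** Write f = cos^n. As k grows, over a short interval f(x) is almost constant
    while f(kx) runs through whole cycles, so that x and kx become independent
    and the areas tend to the mean of |f(x) - f(y)| over y, integrated over x.
    The function f is even and 2a-periodic, and decreasing on [0, a], with
    a = PI for odd n and a = PI/2 for even n. Thus every interval
    [ja, (j+1)a] is a translated or reflected copy of [0, a]
    ([RInt_fold]). Cutting [0, ma] into the mk cells [ja/k, (j+1)a/k] and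
    freezing x at the left end of each cell changes the integral by O(1/k^2)
    per cell, because f is Lipschitz ([cell_error]). Summing the errors gives
    the limit ([oscillation_limit])
      (m/a) * int_0^a int_0^a |f(x) - f(y)| dy dx.

    Since f is monotone on [0, a], the absolute value can be removed, and the
    double integral equals 2 * int_0^a (a - 2x) f(x) dx
    ([RInt_deviation_of_decreasing]). With m = PI/a, this yields
    A_n = (2m^2/PI) * int_0^a (a - 2x) cos^n x dx ([area_seq_limit]).

    Finally (cos^(n-1) sin)' = n cos^n - (n-1) cos^(n-2), and integrating this
    against a - 2x gives the recurrence ([moment_recurrence]). Its
    inhomogeneous term is (2/n)(1 - cos^n a), which is 4/n for odd n (cos a = -1)
    and 2/n for even n (cos a = 0); multiplied by 2m^2/(n PI), with m = 1 and
    m = 2 respectively, these become 8/(n^2 PI) and 16/(n^2 PI). *)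

(** * Continuity and integral estimates *)

(** Integrals have their values in a normed module convertible to R, but the
    ring tactics recognise equations only when they are typed in R itself. *)
Ltac real_eq := lazymatch goal with |- @eq _ ?x ?y => change (@eq R x y) end.

Lemma lipschitz_constant_nonneg (f : R -> R) (L : R) :
  (forall x y, Rabs (f x - f y) <= L * Rabs (x - y)) -> 0 <= L.
Proof.
  intros f_lip.
  pose proof (f_lip 1 0) as H. pose proof (Rabs_pos (f 1 - f 0)).
  replace (1 - 0) with 1 in H by ring. rewrite Rabs_R1 in H. lra.
Qed.

Lemma lipschitz_continuous (f : R -> R) (L : R) :
  (forall x y, Rabs (f x - f y) <= L * Rabs (x - y)) ->
  forall x, continuous f x.
Proof.
  intros Hf x. apply continuity_pt_filterlim.
  intros eps Heps.
  pose proof (lipschitz_constant_nonneg f L Hf) as HL.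
  (* L + 1 rather than L, which may be 0 *)
  exists (eps / (L + 1)). split.
  - apply Rdiv_lt_0_compat; lra.
  - intros y [_ Hy]. simpl in *. unfold Rdist in *.
    apply Rle_lt_trans with (1 := Hf y x).
    apply Rmult_lt_compat_l with (r := L + 1) in Hy; [|lra].
    replace ((L + 1) * (eps / (L + 1))) with eps in Hy by (field; lra).
    pose proof (Rabs_pos (y - x)). nra.
Qed.

Lemma ex_RInt_everywhere_continuous (f : R -> R) :
  (forall x, continuous f x) -> forall a b, ex_RInt f a b.
Proof.
  intros Hf a b. apply (ex_RInt_continuous (V := R_CompleteNormedModule)).
  intros z _. apply Hf.
Qed.

Lemma continuous_Rabs_minus (f g : R -> R) (x : R) :
  continuous f x -> continuous g x ->
  continuous (fun t => Rabs (f t - g t)) x.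
Proof.
  intros Hf Hg. apply (continuous_comp (fun t => f t - g t) Rabs).
  - apply (continuous_minus f g); assumption.
  - apply continuous_Rabs.
Qed.

Lemma RInt_diff_le (f g : R -> R) (p q e : R) :
  p <= q -> ex_RInt f p q -> ex_RInt g p q ->
  (forall x, p <= x <= q -> Rabs (f x - g x) <= e) ->
  Rabs (RInt f p q - RInt g p q) <= (q - p) * e.
Proof.
  intros Hpq Hf Hg H.
  replace (RInt f p q - RInt g p q) with (RInt (fun x => f x - g x) p q).
  - apply (abs_RInt_le_const (fun x => f x - g x) p q e Hpq); [|exact H].
    apply (ex_RInt_minus f g); assumption.
  - apply (RInt_minus f g); assumption.
Qed.

Lemma RInt_pieces_le (u : R -> R) (d e : R) :
  (forall p q, ex_RInt u p q) ->
  (forall j : nat, Rabs (RInt u (INR j * d) (INR (S j) * d)) <= e) ->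
  forall N : nat, Rabs (RInt u 0 (INR N * d)) <= INR N * e.
Proof.
  intros Hu H N. induction N as [|N IH].
  - simpl. rewrite !Rmult_0_l, RInt_point. change (Rabs 0 <= 0). rewrite Rabs_R0. lra.
  - rewrite <- (RInt_Chasles u 0 (INR N * d)) by apply Hu.
    pose proof (H N) as HN.
    pose proof (Rabs_triang (RInt u 0 (INR N * d))
      (RInt u (INR N * d) (INR (S N) * d))) as T.
    rewrite (S_INR N) in *. change plus with Rplus. lra.
Qed.

(** * Functions that are even and periodic *)

(** The reflection x -> 2(j+1)a - x preserves h and exchanges [ja, (j+1)a] with
    the next interval, so neighbouring intervals carry the same integral. *)
Lemma RInt_fold (h : R -> R) (a : R) :
  (forall x, continuous h x) ->
  (forall x, h (- x) = h x) -> (forall x, h (x + 2 * a) = h x) ->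
  forall j : nat, RInt h (INR j * a) (INR (S j) * a) = RInt h 0 a.
Proof.
  intros Hc Heven Hper.
  assert (Hstep : forall j : nat,
    RInt h (INR (S j) * a) (INR (S (S j)) * a) = RInt h (INR j * a) (INR (S j) * a)).
  { intros j.
    assert (Hsym : forall (i : nat) x, h (- x + INR i * (2 * a)) = h x).
    { intros i; induction i as [|i IH]; intros x.
      - simpl. rewrite Rmult_0_l, Rplus_0_r. apply Heven.
      - rewrite S_INR, <- (IH x), <- (Hper (- x + INR i * (2 * a))).
        f_equal. ring. }
    pose proof (RInt_comp_lin h (-1) (INR (S j) * (2 * a)) (INR j * a) (INR (S j) * a)) as Hl.
    rewrite <- (RInt_ext (fun y => opp (h y))) in Hl.
    2:{ intros x _. rewrite <- (Hsym (S j) x).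
        change (- h (- x + INR (S j) * (2 * a)) = -1 * h (-1 * x + INR (S j) * (2*a))).
        replace (-1 * x) with (- x) by ring. ring. }
    replace (-1 * (INR j * a) + INR (S j) * (2 * a)) with (INR (S (S j)) * a) in Hl
      by (rewrite !S_INR; ring).
    replace (-1 * (INR (S j) * a) + INR (S j) * (2 * a)) with (INR (S j) * a) in Hl
      by (rewrite !S_INR; ring).
    rewrite (RInt_opp (V := R_CompleteNormedModule) h) in Hl
      by (apply ex_RInt_everywhere_continuous, Hc).
    specialize (Hl (ex_RInt_everywhere_continuous h Hc _ _)).
    rewrite <- (opp_RInt_swap (V := R_CompleteNormedModule) h (INR (S j) * a)
      (INR (S (S j)) * a)) in Hl by (apply ex_RInt_everywhere_continuous, Hc).
    apply Ropp_eq_reg. symmetry. exact Hl. }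
  intros j; induction j as [|j IH].
  - simpl. f_equal; ring.
  - rewrite Hstep. exact IH.
Qed.

(** * Oscillation of f(x) against f(kx) *)

Section Oscillation.

Variables (f : R -> R) (a L : R).
Hypothesis a_pos : 0 < a.
Hypothesis f_even : forall x, f (- x) = f x.
Hypothesis f_per : forall x, f (x + 2 * a) = f x.
Hypothesis f_lip : forall x y, Rabs (f x - f y) <= L * Rabs (x - y).

Let f_cont : forall x, continuous f x := lipschitz_continuous f L f_lip.

Let L_pos : 0 <= L := lipschitz_constant_nonneg f L f_lip.

Definition deviation (x : R) : R := RInt (fun y => Rabs (f x - f y)) 0 a.

Let cont_dev (c : R) : forall y, continuous (fun y => Rabs (c - f y)) y.
Proof.
  intros y. apply (continuous_Rabs_minus (fun _ => c) f);
    [apply continuous_const | apply f_cont].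
Qed.

Let cont_scaled (c k : R) : forall y, continuous (fun y => Rabs (c - f (k * y))) y.
Proof.
  intros y. apply (continuous_comp (fun y => k * y) (fun z => Rabs (c - f z))).
  - apply (continuous_scal_r k (fun y : R => y)), continuous_id.
  - apply cont_dev.
Qed.

Let cont_osc (k : R) : forall y, continuous (fun y => Rabs (f y - f (k * y))) y.
Proof.
  intros y. apply (continuous_Rabs_minus f (fun y => f (k * y))); [apply f_cont|].
  apply (continuous_comp (fun y => k * y) f); [|apply f_cont].
  apply (continuous_scal_r k (fun y : R => y)), continuous_id.
Qed.

Let abs_lip (x p c : R) :
  Rabs (Rabs (f x - c) - Rabs (f p - c)) <= L * Rabs (x - p).
Proof.
  apply Rle_trans with (1 := Rabs_triang_inv2 (f x - c) (f p - c)).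
  replace (f x - c - (f p - c)) with (f x - f p) by ring. apply f_lip.
Qed.

Lemma deviation_lipschitz (x p : R) :
  Rabs (deviation x - deviation p) <= (a * L) * Rabs (x - p).
Proof.
  unfold deviation.
  replace (a * L * Rabs (x - p)) with ((a - 0) * (L * Rabs (x - p))) by ring.
  apply RInt_diff_le; try (apply ex_RInt_everywhere_continuous, cont_dev); [lra|].
  intros y _. apply abs_lip.
Qed.

Lemma deviation_continuous (x : R) : continuous deviation x.
Proof. apply (lipschitz_continuous _ _ deviation_lipschitz). Qed.

(** As x crosses one cell, kx crosses exactly one interval [ja, (j+1)a]; the
    oscillating factor is thus averaged over a whole copy of [0, a]. *)
Lemma RInt_rescaled_cell (k c : R) (j : nat) :
  0 < k ->
  RInt (fun x => Rabs (c - f (k * x))) (INR j * (a / k)) (INR (S j) * (a / k))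
  = / k * RInt (fun y => Rabs (c - f y)) 0 a.
Proof.
  intros Hk.
  rewrite <- (RInt_fold (fun y => Rabs (c - f y)) a (cont_dev c)) with (j := j).
  2: intros x; now rewrite f_even.
  2: intros x; now rewrite f_per.
  pose proof (RInt_comp_lin (fun y => Rabs (c - f y)) k 0
    (INR j * (a / k)) (INR (S j) * (a / k))) as Hl.
  rewrite RInt_scal in Hl.
  2:{ apply ex_RInt_everywhere_continuous. intros y.
      apply continuous_ext with (f := fun y => Rabs (c - f (k * y))).
      - intros z. now rewrite Rplus_0_r.
      - apply cont_scaled. }
  replace (k * (INR j * (a / k)) + 0) with (INR j * a) in Hl by (field; lra).
  replace (k * (INR (S j) * (a / k)) + 0) with (INR (S j) * a) in Hl by (field; lra).
  rewrite <- Hl by (apply ex_RInt_everywhere_continuous, cont_dev).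
  rewrite (RInt_ext (fun y => Rabs (c - f (k * y + 0))) (fun y => Rabs (c - f (k * y)))).
  2: intros z _; now rewrite Rplus_0_r.
  change scal with Rmult. symmetry. real_eq. field. lra.
Qed.

(** On a cell with left end p, both |f(x) - f(kx)| and the mean deviation change by
    at most L * (a/k) when the free x is replaced by p. After the replacement
    their integrals agree exactly by [RInt_rescaled_cell]. Each of the two
    errors, integrated over the length a/k, is at most L * (a/k)^2. *)
Lemma cell_error (k : R) (j : nat) :
  0 < k ->
  Rabs (RInt (fun x => Rabs (f x - f (k * x)) - / a * deviation x)
    (INR j * (a / k)) (INR (S j) * (a / k))) <= 2 * L * (a / k) ^ 2.
Proof.
  intros Hk. set (p := INR j * (a / k)).
  assert (Hak : 0 < a / k) by now apply Rdiv_lt_0_compat.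
  assert (Hq : INR (S j) * (a / k) = p + a / k) by (unfold p; rewrite S_INR; ring).
  rewrite Hq.
  assert (Hdc : forall x, continuous (fun x => / a * deviation x) x).
  { intros x. apply (continuous_scal_r (/ a) deviation), deviation_continuous. }
  pose proof (RInt_rescaled_cell k (f p) j Hk) as Hfr. fold p in Hfr. rewrite Hq in Hfr.
  change (RInt (fun y => Rabs (f p - f y)) 0 a) with (deviation p) in Hfr.
  rewrite (RInt_minus (V := R_CompleteNormedModule)
    (fun x => Rabs (f x - f (k * x))) (fun x => / a * deviation x)).
  2: apply ex_RInt_everywhere_continuous, cont_osc.
  2: now apply ex_RInt_everywhere_continuous.
  assert (Hx : forall x, p <= x <= p + a / k -> L * Rabs (x - p) <= L * (a / k)).
  { intros x Hx. apply Rmult_le_compat_l; [exact L_pos|]. rewrite Rabs_pos_eq; lra. }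
  assert (E1 := RInt_diff_le (fun x => Rabs (f x - f (k * x)))
    (fun x => Rabs (f p - f (k * x))) p (p + a / k) (L * (a / k))
    ltac:(lra)
    (ex_RInt_everywhere_continuous _ (cont_osc k) _ _)
    (ex_RInt_everywhere_continuous _ (cont_scaled (f p) k) _ _)
    (fun x H => Rle_trans _ _ _ (abs_lip x p (f (k * x))) (Hx x H))).
  assert (E2 : Rabs (RInt (fun x => / a * deviation x) p (p + a / k)
                - RInt (fun _ => / a * deviation p) p (p + a / k))
                <= (p + a / k - p) * (L * (a / k))).
  { apply RInt_diff_le;
      [lra | now apply ex_RInt_everywhere_continuous | apply ex_RInt_const |].
    intros x H. rewrite <- Rmult_minus_distr_l, Rabs_mult.
    rewrite (Rabs_pos_eq (/ a)) by (left; now apply Rinv_0_lt_compat).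
    apply Rle_trans with (2 := Hx x H).
    apply Rle_trans with (/ a * (a * L * Rabs (x - p))).
    - apply Rmult_le_compat_l; [left; now apply Rinv_0_lt_compat | apply deviation_lipschitz].
    - right. field. lra. }
  rewrite Hfr in E1.
  rewrite (RInt_const (V := R_CompleteNormedModule)) in E2.
  assert (Hc : (p + a / k - p) * (/ a * deviation p) = / k * deviation p) by (field; lra).
  change scal with Rmult in E2. rewrite Hc in E2.
  change minus with Rminus.
  replace (RInt (fun x => Rabs (f x - f (k * x))) p (p + a / k) -
    RInt (fun x => / a * deviation x) p (p + a / k)) with
    ((RInt (fun x => Rabs (f x - f (k * x))) p (p + a / k) - / k * deviation p)
     - (RInt (fun x => / a * deviation x) p (p + a / k) - / k * deviation p)) by ring.
  apply Rle_trans with (1 := Rabs_triang _ _). rewrite Rabs_Ropp.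
  replace (2 * L * (a / k) ^ 2) with
    ((p + a / k - p) * (L * (a / k)) + (p + a / k - p) * (L * (a / k))) by ring.
  now apply Rplus_le_compat.
Qed.

(** The mk cell errors of order k^-2 add up to 2mLa^2/k. The outer integral of the
    deviation folds m times onto [0, a], since it is itself even and
    2a-periodic in x. *)
Lemma oscillation_limit (m : nat) :
  is_lim_seq
    (fun k => RInt (fun x => Rabs (f x - f (INR (S k) * x))) 0 (INR m * a))
    (INR m / a * RInt deviation 0 a).
Proof.
  assert (Hdc : forall x, continuous (fun x => / a * deviation x) x).
  { intros x. apply (continuous_scal_r (/ a) deviation), deviation_continuous. }
  assert (Hcell : forall j : nat, RInt deviation (INR j * a) (INR (S j) * a) = RInt deviation 0 a).
  { apply RInt_fold.
    - apply deviation_continuous.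
    - intros x. unfold deviation. now rewrite f_even.
    - intros x. unfold deviation. now rewrite f_per. }
  assert (Hm : RInt deviation 0 (INR m * a) = INR m * RInt deviation 0 a).
  { induction m as [|i IH].
    - simpl. rewrite !Rmult_0_l. apply (RInt_point (V := R_CompleteNormedModule)).
    - rewrite <- (RInt_Chasles deviation 0 (INR i * a))
        by (apply ex_RInt_everywhere_continuous, deviation_continuous).
      rewrite IH, Hcell, S_INR. change plus with Rplus. real_eq. ring. }
  assert (Hz : is_lim_seq (fun k => INR m * 2 * L * a ^ 2 * / INR (S k)) 0).
  { replace 0 with (INR m * 2 * L * a ^ 2 * 0) by ring.
    apply (is_lim_seq_scal_l _ _ (Finite 0)).
    apply (is_lim_seq_incr_1 (fun k => / INR k)).
    apply (is_lim_seq_inv INR p_infty); [apply is_lim_seq_INR | easy]. }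
  apply is_lim_seq_le_le with
    (u := fun k => INR m / a * RInt deviation 0 a - INR m * 2 * L * a ^ 2 * / INR (S k))
    (w := fun k => INR m / a * RInt deviation 0 a + INR m * 2 * L * a ^ 2 * / INR (S k)).
  - intros k.
    assert (Hk : 0 < INR (S k)) by (apply lt_0_INR; lia).
    assert (Hc : forall x, continuous (fun x => Rabs (f x - f (INR (S k) * x)) - / a * deviation x) x).
    { intros x.
      apply (continuous_minus (fun x => Rabs (f x - f (INR (S k) * x))) (fun x => / a * deviation x)).
      - apply cont_osc.
      - apply Hdc. }
    pose proof (RInt_pieces_le _ (a / INR (S k)) (2 * L * (a / INR (S k)) ^ 2)
      (ex_RInt_everywhere_continuous _ Hc) (fun j => cell_error (INR (S k)) j Hk) (m * S k)) as H.
    rewrite mult_INR in H.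
    replace (INR m * INR (S k) * (a / INR (S k))) with (INR m * a) in H by (field; lra).
    rewrite (RInt_minus (V := R_CompleteNormedModule)
      (fun x => Rabs (f x - f (INR (S k) * x))) (fun x => / a * deviation x)) in H.
    2: apply ex_RInt_everywhere_continuous, cont_osc.
    2: now apply ex_RInt_everywhere_continuous.
    rewrite (RInt_scal (V := R_CompleteNormedModule) deviation) in H
      by (apply ex_RInt_everywhere_continuous, deviation_continuous).
    rewrite Hm in H.
    change minus with Rminus in H. change scal with Rmult in H.
    replace (/ a * (INR m * RInt deviation 0 a)) with (INR m / a * RInt deviation 0 a) in H
      by (field; lra).
    replace (INR m * INR (S k) * (2 * L * (a / INR (S k)) ^ 2))
      with (INR m * 2 * L * a ^ 2 * / INR (S k)) in H by (field; lra).
    apply Rabs_le_between in H. lra.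
  - replace (INR m / a * RInt deviation 0 a) with (INR m / a * RInt deviation 0 a - 0) at 1 by ring.
    apply is_lim_seq_minus'; [apply is_lim_seq_const | exact Hz].
  - replace (INR m / a * RInt deviation 0 a) with (INR m / a * RInt deviation 0 a + 0) at 1 by ring.
    apply is_lim_seq_plus'; [apply is_lim_seq_const | exact Hz].
Qed.

(** * The double integral for a monotone function *)

Hypothesis f_dec : forall x y, 0 <= x -> x <= y -> y <= a -> f y <= f x.

Let f_int : forall p q, ex_RInt f p q := ex_RInt_everywhere_continuous f f_cont.

Lemma deviation_of_decreasing (x : R) :
  0 <= x <= a ->
  deviation x = (a - 2 * x) * f x + 2 * RInt f 0 x - RInt f 0 a.
Proof.
  intros [H0 Ha]. unfold deviation.
  rewrite <- (RInt_Chasles _ 0 x a) by (apply ex_RInt_everywhere_continuous, cont_dev).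
  rewrite (RInt_ext _ (fun y => f y - f x) 0 x).
  2:{ intros y. rewrite Rmin_left, Rmax_right by lra. intros Hy.
      rewrite Rabs_left1; [real_eq; ring|]. specialize (f_dec y x). lra. }
  rewrite (RInt_ext _ (fun y => f x - f y) x a).
  2:{ intros y. rewrite Rmin_left, Rmax_right by lra. intros Hy.
      rewrite Rabs_pos_eq; [real_eq; ring|]. specialize (f_dec x y). lra. }
  rewrite (RInt_minus f (fun _ => f x)) by (apply f_int || apply ex_RInt_const).
  rewrite (RInt_minus (fun _ => f x) f) by (apply f_int || apply ex_RInt_const).
  rewrite !RInt_const, <- (RInt_Chasles f 0 x a) by apply f_int.
  change minus with Rminus; change plus with Rplus; change scal with Rmult.
  real_eq.
  ring_simplify. reflexivity.
Qed.

(** With F the primitive of f vanishing at 0, the deviation exceeds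
    2(a - 2x)f(x) by the derivative of (2x - a)F(x) - F(a)x, which vanishes
    at both ends of [0, a]. *)
Lemma RInt_deviation_of_decreasing :
  RInt deviation 0 a = 2 * RInt (fun x => (a - 2 * x) * f x) 0 a.
Proof.
  assert (Hw : forall x, continuous (fun x => (a - 2 * x) * f x) x).
  { intros x. apply (continuous_mult (fun x => a - 2 * x) f); [|apply f_cont].
    apply (ex_derive_continuous (fun x => a - 2 * x)). auto_derive. easy. }
  set (F := (fun x => RInt f 0 x) : R -> R).
  assert (HF : forall x, is_derive F x (f x)).
  { intros x. apply (is_derive_RInt f F 0 x); [|apply f_cont].
    apply filter_forall. intros y. apply (RInt_correct f), f_int. }
  assert (HFc : forall x, continuous F x).
  { intros x. apply (ex_derive_continuous F). exists (f x). apply HF. }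
  set (g := fun x => 2 * F x + (2 * x - a) * f x - F a).
  assert (Hg : is_RInt g 0 a
     (minus ((2 * a - a) * F a - F a * a) ((2 * 0 - a) * F 0 - F a * 0))).
  { apply (is_RInt_derive (fun x => (2 * x - a) * F x - F a * x)).
    - intros x _. unfold g. auto_derive.
      + exists (f x). apply HF.
      + replace (Derive (fun t => F t) x) with (f x)
          by (symmetry; apply is_derive_unique, HF).
        ring.
    - intros x _. unfold g.
      apply (continuous_minus (fun x => 2 * F x + (2 * x - a) * f x) (fun _ => F a));
        [|apply continuous_const].
      apply (continuous_plus (fun x => 2 * F x) (fun x => (2 * x - a) * f x)).
      + apply (continuous_scal_r 2 F), HFc.
      + apply (continuous_mult (fun x => 2 * x - a) f); [|apply f_cont].
        apply (ex_derive_continuous (fun x => 2 * x - a)). auto_derive. easy. }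
  rewrite (RInt_ext deviation (fun x => g x + 2 * ((a - 2 * x) * f x))).
  2:{ intros x. rewrite Rmin_left, Rmax_right by lra. intros Hx.
      rewrite deviation_of_decreasing by lra. unfold g, F. real_eq. ring. }
  rewrite (RInt_plus g (fun x => 2 * ((a - 2 * x) * f x))).
  2: eexists; exact Hg.
  2: apply ex_RInt_everywhere_continuous; intros x;
     apply (continuous_scal_r 2 (fun x => (a - 2 * x) * f x)), Hw.
  rewrite (is_RInt_unique _ _ _ _ Hg).
  rewrite (RInt_scal (fun x => (a - 2 * x) * f x))
    by apply (ex_RInt_everywhere_continuous _ Hw).
  assert (HF0 : F 0 = 0) by apply (RInt_point 0 f).
  change minus with Rminus; change plus with Rplus; change scal with Rmult.
  real_eq.
  rewrite HF0. ring.
Qed.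

End Oscillation.

(** * Powers of the cosine *)

Lemma cos_pow_lipschitz (n : nat) (x y : R) :
  Rabs (cos x ^ n - cos y ^ n) <= INR n * Rabs (x - y).
Proof.
  assert (Hcos : Rabs (cos x - cos y) <= Rabs (x - y)).
  { destruct (MVT_gen cos y x (fun t => - sin t)) as [c [_ Hc]].
    - intros t _. auto_derive; [easy | ring].
    - intros t _. apply continuity_cos.
    - rewrite Hc, Rabs_mult, Rabs_Ropp.
      pose proof (SIN_bound c). pose proof (Rabs_pos (x - y)).
      assert (Rabs (sin c) <= 1) by (apply Rabs_le; lra). nra. }
  assert (Hb : forall t, Rabs (cos t) <= 1).
  { intros t. apply Rabs_le. apply COS_bound. }
  induction n as [|n IH].
  - simpl. rewrite Rminus_diag, Rabs_R0. lra.
  - replace (cos x ^ S n - cos y ^ S n)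
      with (cos x * (cos x ^ n - cos y ^ n) + (cos x - cos y) * cos y ^ n) by (simpl; ring).
    apply Rle_trans with (1 := Rabs_triang _ _). rewrite !Rabs_mult, S_INR.
    assert (Hy : Rabs (cos y ^ n) <= 1).
    { rewrite <- RPow_abs, <- (pow1 n). apply pow_incr. split; [apply Rabs_pos | apply Hb]. }
    pose proof (Hb x). pose proof (Rabs_pos (cos x)).
    pose proof (Rabs_pos (cos x ^ n - cos y ^ n)). pose proof (Rabs_pos (cos x - cos y)).
    pose proof (Rabs_pos (cos y ^ n)). nra.
Qed.

Lemma pow_odd_incr (n : nat) (x y : R) :
  Nat.odd n = true -> x <= y -> x ^ n <= y ^ n.
Proof.
  intros Hn Hxy. apply Nat.odd_spec in Hn. destruct Hn as [p ->].
  rewrite Nat.add_1_r.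
  assert (Hneg : forall z, (- z) ^ S (2 * p) = - z ^ S (2 * p)).
  { intros z. rewrite <- !tech_pow_Rmult, !pow_mult.
    replace ((- z) ^ 2) with (z ^ 2) by ring. ring. }
  destruct (Rle_dec 0 x) as [Hx|Hx].
  - apply pow_incr; lra.
  - destruct (Rle_dec 0 y) as [Hy|Hy].
    + apply Rle_trans with 0; [|now apply pow_le].
      replace x with (- (- x)) by ring. rewrite Hneg.
      pose proof (pow_le (- x) (S (2 * p))). lra.
    + replace x with (- (- x)) by ring. replace y with (- (- y)) by ring.
      rewrite (Hneg (- x)), (Hneg (- y)). apply Ropp_le_contravar, pow_incr. lra.
Qed.

(** The number m of copies of [0, PI/m] in [0, PI], on each of which cos^n is
    monotone and next to which it continues by reflection. *)
Definition folds (n : nat) : nat := if Nat.odd n then 1%nat else 2%nat.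

Definition moment (n : nat) (a : R) : R := RInt (fun x => (a - 2 * x) * cos x ^ n) 0 a.

Lemma area_seq_limit (n : nat) :
  is_lim_seq (area_seq n)
    (2 * INR (folds n) ^ 2 / PI * moment n (PI / INR (folds n))).
Proof.
  pose proof PI_RGT_0 as Hpi.
  set (m := folds n). set (a := PI / INR m).
  assert (Hm : 0 < INR m) by (unfold m, folds; destruct (Nat.odd n); simpl; lra).
  assert (Ha : 0 < a) by now apply Rdiv_lt_0_compat.
  assert (Hma : INR m * a = PI) by (unfold a; field; lra).
  assert (Heven : forall x, cos (- x) ^ n = cos x ^ n) by (intros x; now rewrite cos_neg).
  assert (Hper : forall x, cos (x + 2 * a) ^ n = cos x ^ n).
  { intros x. unfold a, m, folds. destruct (Nat.odd n) eqn:Hn.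
    - simpl (INR 1). replace (x + 2 * (PI / 1)) with (x + 2 * INR 1 * PI) by (simpl; field).
      now rewrite cos_period.
    - simpl (INR 2). replace (x + 2 * (PI / (1 + 1))) with (x + PI) by field.
      rewrite neg_cos. rewrite <- Nat.negb_even in Hn. apply Bool.negb_false_iff in Hn.
      apply Nat.even_spec in Hn. destruct Hn as [p ->].
      rewrite !pow_mult. f_equal. ring. }
  assert (Hdec : forall x y, 0 <= x -> x <= y -> y <= a -> cos y ^ n <= cos x ^ n).
  { unfold a, m, folds. intros x y H0 Hxy Hy. destruct (Nat.odd n) eqn:Hn; simpl in Hy.
    - apply pow_odd_incr; [exact Hn|]. apply cos_decr_1; lra.
    - apply pow_incr. split; [apply cos_ge_0; lra | apply cos_decr_1; lra]. }
  pose proof (oscillation_limit (fun x => cos x ^ n) a (INR n) Ha Heven Hper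
    (cos_pow_lipschitz n) m) as H.
  rewrite (RInt_deviation_of_decreasing (fun x => cos x ^ n) a (INR n) Ha
    (cos_pow_lipschitz n) Hdec) in H.
  rewrite Hma in H. fold (moment n a) in H.
  replace (2 * INR m ^ 2 / PI * moment n a) with (INR m / a * (2 * moment n a)).
  - exact H.
  - unfold a. field. lra.
Qed.

(** Integration by parts of a - 2x against
    (cos^(n+1) sin)' = (n+2) cos^(n+2) - (n+1) cos^n. The hypothesis on a
    makes the boundary term vanish; the remaining integral of 2 cos^(n+1) sin
    is elementary. *)
Lemma moment_recurrence (n : nat) (a : R) :
  cos a ^ S n * sin a = 0 ->
  INR (n + 2) * moment (n + 2) a =
  INR (n + 1) * moment n a + 2 / INR (n + 2) * (1 - cos a ^ (n + 2)).
Proof.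
  intros Ha. unfold moment.
  assert (Hn : 0 < INR (n + 2)) by (apply lt_0_INR; lia).
  assert (Hex : forall i, ex_RInt (fun x => (a - 2 * x) * cos x ^ i) 0 a).
  { intros i. apply ex_RInt_everywhere_continuous. intros x.
    apply (ex_derive_continuous (fun x => (a - 2 * x) * cos x ^ i)). auto_derive. easy. }
  (* the last term of P is the primitive of 2 cos^(n+1) sin, which cancels
     the derivative of the weight a - 2x *)
  set (P := fun x => (a - 2 * x) * (cos x ^ S n * sin x)
                     - 2 / INR (n + 2) * cos x ^ (n + 2)).
  assert (H : is_RInt (fun x => INR (n + 2) * ((a - 2 * x) * cos x ^ (n + 2))
      - INR (n + 1) * ((a - 2 * x) * cos x ^ n)) 0 a (minus (P a) (P 0))).
  { apply (is_RInt_derive P).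
    - intros x _. unfold P. auto_derive; [easy|].
      replace (Nat.pred (n + 2)) with (S n) by lia.
      change (Nat.pred (S n)) with n.
      replace (n + 2)%nat with (S (S n)) in * by lia.
      replace (n + 1)%nat with (S n) by lia.
      assert (Hs : sin x * sin x = 1 - cos x * cos x).
      { pose proof (sin2_cos2 x). unfold Rsqr in *. lra. }
      change (match n with 0%nat => 1 | S _ => INR n + 1 end) with (INR (S n)).
      rewrite <- !tech_pow_Rmult. rewrite !S_INR in *.
      field_simplify; [|lra].
      replace (sin x ^ 2) with (1 - cos x * cos x) by (rewrite <- Hs; ring).
      ring.
    - intros x _.
      apply (ex_derive_continuous (fun x => INR (n + 2) * ((a - 2 * x) * cos x ^ (n + 2))
      - INR (n + 1) * ((a - 2 * x) * cos x ^ n))). auto_derive. easy. }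
  apply (is_RInt_unique (V := R_CompleteNormedModule)) in H.
  rewrite (RInt_minus (V := R_CompleteNormedModule)
     (fun x => INR (n + 2) * ((a - 2 * x) * cos x ^ (n + 2)))
     (fun x => INR (n + 1) * ((a - 2 * x) * cos x ^ n))) in H.
  2, 3: apply (ex_RInt_scal (V := R_NormedModule)), Hex.
  rewrite !(RInt_scal (V := R_CompleteNormedModule) (fun x => (a - 2 * x) * cos x ^ _)) in H
    by apply Hex.
  change minus with Rminus in H; change scal with Rmult in H.
  unfold P in H. rewrite Ha, sin_0, cos_0, !pow1 in H. lra.
Qed.

Theorem theorem3 (n : nat) (hn : (3 <= n)%nat) :
  ex_finite_lim_seq (area_seq n) /\
  ex_finite_lim_seq (area_seq (n - 2)) /\
  A n = (INR n - 1) / INR n * A (n - 2) +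
        (if Nat.odd n then 8 / (INR n ^ 2 * PI) else 16 / (INR n ^ 2 * PI)).
Proof.
  pose proof PI_RGT_0 as Hpi.
  split; [|split]; [eexists; apply area_seq_limit | eexists; apply area_seq_limit |].
  unfold A. rewrite !(is_lim_seq_unique _ _ (area_seq_limit _)). simpl real.
  destruct (Nat.le_exists_sub 2 n ltac:(lia)) as [p [-> _]].
  rewrite Nat.add_sub.
  assert (Hn : 0 < INR (p + 2)) by (apply lt_0_INR; lia).
  assert (Hp : INR (p + 1) = INR (p + 2) - 1) by (rewrite !plus_INR; simpl; ring).
  assert (Hodd : Nat.odd (p + 2) = Nat.odd p)
    by (rewrite Nat.odd_add; now destruct (Nat.odd p)).
  assert (Hf : folds (p + 2) = folds p) by (unfold folds; now rewrite Hodd).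
  rewrite Hf.
  assert (Hrec : cos (PI / INR (folds p)) ^ S p * sin (PI / INR (folds p)) = 0).
  { unfold folds. destruct (Nat.odd p); simpl INR.
    - replace (PI / 1) with PI by field. rewrite sin_PI. ring.
    - replace (1 + 1) with 2 by ring. rewrite cos_PI2, pow_i by lia. ring. }
  apply moment_recurrence in Hrec. rewrite Hp in Hrec.
  set (M := moment (p + 2) _) in *. set (N := moment p _) in *.
  replace M with (((INR (p + 2) - 1) * N
      + 2 / INR (p + 2) * (1 - cos (PI / INR (folds p)) ^ (p + 2))) / INR (p + 2))
    by (rewrite <- Hrec; field; lra).
  clearbody M N. clear Hrec M.
  unfold folds. rewrite Hodd. destruct (Nat.odd p) eqn:Hop; simpl INR.
  - replace (PI / 1) with PI by field. rewrite cos_PI.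
    apply Nat.odd_spec in Hop. destruct Hop as [q ->].
    replace (2 * q + 1 + 2)%nat with (S (2 * S q)) in * by lia.
    rewrite pow_1_odd. field. lra.
  - replace (1 + 1) with 2 by ring. rewrite cos_PI2, pow_i by lia. field. lra.
Qed.
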